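(* Let $\Gamma$ be a (finitely generated) hyperbolic group and $\mathbb{K}=\mathbb{R}$ or $\mathbb{C}$. Then there exists $2\le p(\Gamma)<\infty$ such that for any N-functions $\Phi$ and $\Psi$ with $\Phi\in\Delta_2^{\mathbb{N}}$ and such that there are constants $D>0$, $t_0>0$ with $\Psi(t)\le Dt^{p(\Gamma)}$ for all $0<t\le t_0$, the group $\Gamma$ admits a proper affine isometric action on the space $\ell^\Psi(\Gamma,\ell^\Phi(\Gamma,\mathbb{K}))$ equipped with the gauge norm $\|\cdot\|_{(\Psi\Phi)}$.
   Context: An N-function is a convex $\Phi:[0,\infty)\to[0,\infty)$ with $\Phi(0)=0$, $0<\Phi(t)<\infty$ for $t>0$, $\lim_{t\to0}\Phi(t)/t=0$, $\lim_{t\to\infty}\Phi(t)/t=\infty$. $\Phi\in\Delta_2^{\mathbb{N}}$ means there are $K,t_0>0$ with $\Phi(2t)\le K\Phi(t)$ for all $0<t\le t_0$. $\ell^\Phi(\Gamma,\mathbb{K})$ is the space of $c:\Gamma\to\mathbb{K}$ with $\sum_\gamma\Phi(a|c_\gamma|)<\infty$ for some $a>0$, with gauge norm $\|c\|_{(\Phi)}=\inf\{b>0:\sum_{\gamma\in\Gamma}\Phi(|c_\gamma|/b)\le1\}$. $\ell^\Psi(\Gamma,\ell^\Phi(\Gamma,\mathbb{K}))$ is the space of maps $\xi:\Gamma\to\ell^\Phi(\Gamma,\mathbb{K})$ with $\sum_{\gamma\in\Gamma}\Psi(a\|\xi(\gamma)\|_{(\Phi)})<\infty$ for some $a>0$,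 with gauge norm $\|\xi\|_{(\Psi\Phi)}=\inf\{b>0:\sum_{\gamma\in\Gamma}\Psi(\|\xi(\gamma)\|_{(\Phi)}/b)\le1\}$. An affine isometric action $\beta$ of $\Gamma$ on a Banach space $X$ is proper if $\|\beta(g)\xi\|\to\infty$ as $g\to\infty$ in $\Gamma$ (i.e. leaves every finite set), for every $\xi\in X$. *)

(* Defs.v *)
From Stdlib Require Import Reals Lra List Classical ClassicalEpsilon FunctionalExtensionality.
Import ListNotations.
Open Scope R_scope.

Definition is_glb_R (E : R -> Prop) (r : R) : Prop :=
  (forall x, E x -> r <= x) /\ (forall r', (forall x, E x -> r' <= x) -> r' <= r).

Definition InfR (E : R -> Prop) : R :=
  epsilon (inhabits 0) (fun r => is_glb_R E r).

Record Group := {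
  gcar :> Type;
  gmul : gcar -> gcar -> gcar;
  ginv : gcar -> gcar;
  gone : gcar;
  gmul_assoc : forall x y z, gmul x (gmul y z) = gmul (gmul x y) z;
  gmul_1l : forall x, gmul gone x = x;
  gmul_Vl : forall x, gmul (ginv x) x = gone
}.

Definition wlen_le {G : Group} (S : list G) (g : G) (n : nat) : Prop :=
  exists l : list G, (length l <= n)%nat /\
    Forall (fun s => In s S \/ In (ginv G s) S) l /\
    fold_right (gmul G) (gone G) l = g.

Definition generates {G : Group} (S : list G) : Prop :=
  forall g : G, exists n, wlen_le S g n.

(** word length w.r.t. S (the least n; meaningful when S generates) *)
Definition wlen {G : Group} (S : list G) (g : G) : nat :=
  epsilon (inhabits 0%nat)
    (fun n => wlen_le S g n /\ forall m, wlen_le S g m -> (n <= m)%nat).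

Definition wdist {G : Group} (S : list G) (x y : G) : R :=
  INR (wlen S (gmul G (ginv G x) y)).

Definition hyperbolic_wrt {G : Group} (S : list G) : Prop :=
  exists delta : R, 0 <= delta /\
    forall x y z w : G,
      wdist S x y + wdist S z w <=
        Rmax (wdist S x z + wdist S y w) (wdist S x w + wdist S y z) + 2 * delta.

Definition hyperbolic_group (G : Group) : Prop :=
  exists S : list G, generates S /\ hyperbolic_wrt S.

Record Scalars := {
  sc :> Type;
  sadd : sc -> sc -> sc;
  smul : sc -> sc -> sc;
  sabs : sc -> R
}.

Definition RScalars : Scalars :=
  {| sc := R; sadd := Rplus; smul := Rmult; sabs := Rabs |}.

Definition CScalars : Scalars :=
  {| sc := (R * R)%type;
     sadd := fun a b => (fst a + fst b, snd a + snd b);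
     smul := fun a b => (fst a * fst b - snd a * snd b, fst a * snd b + snd a * fst b);
     sabs := fun a => sqrt (fst a * fst a + snd a * snd a) |}.

Definition Kof (complex : bool) : Scalars :=
  if complex then CScalars else RScalars.

Definition N_function (Phi : R -> R) : Prop :=
  (forall x y t, 0 <= x -> 0 <= y -> 0 <= t <= 1 ->
     Phi (t * x + (1 - t) * y) <= t * Phi x + (1 - t) * Phi y) /\
  Phi 0 = 0 /\
  (forall t, 0 < t -> 0 < Phi t) /\
  (forall eps, 0 < eps -> exists d, 0 < d /\ forall t, 0 < t < d -> Phi t / t < eps) /\
  (forall M, exists T, 0 < T /\ forall t, T < t -> M < Phi t / t).

Definition Delta2_N (Phi : R -> R) : Prop :=
  exists K t0, 0 < K /\ 0 < t0 /\ forall t, 0 < t <= t0 -> Phi (2 * t) <= K * Phi t.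

Fixpoint sum_list {A : Type} (f : A -> R) (l : list A) : R :=
  match l with [] => 0 | a :: l' => f a + sum_list f l' end.

(** sum_{x} f x <= M  (for f >= 0: every finite partial sum is <= M) *)
Definition sum_le {A : Type} (f : A -> R) (M : R) : Prop :=
  forall l : list A, NoDup l -> sum_list f l <= M.

Definition sum_finite {A : Type} (f : A -> R) : Prop := exists M, sum_le f M.

Definition in_lPhi {G : Type} {K : Scalars} (Phi : R -> R) (c : G -> K) : Prop :=
  exists a, 0 < a /\ sum_finite (fun g => Phi (a * sabs K (c g))).

Definition gauge {G : Type} {K : Scalars} (Phi : R -> R) (c : G -> K) : R :=
  InfR (fun b => 0 < b /\ sum_le (fun g => Phi (sabs K (c g) / b)) 1).

Definition in_lPsiPhi {G : Type} {K : Scalars} (Psi Phi : R -> R) (xi : G -> G -> K) : Prop :=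
  (forall g, in_lPhi Phi (xi g)) /\
  exists a, 0 < a /\ sum_finite (fun g => Psi (a * gauge Phi (xi g))).

Definition gaugePsiPhi {G : Type} {K : Scalars} (Psi Phi : R -> R) (xi : G -> G -> K) : R :=
  InfR (fun b => 0 < b /\ sum_le (fun g => Psi (gauge Phi (xi g) / b)) 1).

Definition vadd {G : Type} {K : Scalars} (xi eta : G -> G -> K) : G -> G -> K :=
  fun x y => sadd K (xi x y) (eta x y).
Definition vscal {G : Type} {K : Scalars} (k : K) (xi : G -> G -> K) : G -> G -> K :=
  fun x y => smul K k (xi x y).

Definition proper_affine_isometric_action (G : Group) (K : Scalars) (Psi Phi : R -> R) : Prop :=
  let inX := @in_lPsiPhi G K Psi Phi in
  let nrm := @gaugePsiPhi G K Psi Phi in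
  exists (pi : G -> (G -> G -> K) -> (G -> G -> K)) (b : G -> G -> G -> K),
    let beta := fun g xi => vadd (pi g xi) (b g) in
    (forall g, inX (b g)) /\
    (forall g xi, inX xi -> inX (pi g xi)) /\
    (forall g xi eta (k : K), inX xi -> inX eta ->
        pi g (vadd xi (vscal k eta)) = vadd (pi g xi) (vscal k (pi g eta))) /\
    (forall g xi, inX xi -> nrm (pi g xi) = nrm xi) /\
    (forall xi, inX xi -> beta (gone G) xi = xi) /\
    (forall g h xi, inX xi -> beta (gmul G g h) xi = beta g (beta h xi)) /\
    (forall xi, inX xi -> forall M : R, exists L : list G,
        forall g, ~ In g L -> M < nrm (beta g xi)).

(* Main.v *)
Require Import Defs.
From Stdlib Require Import Reals Lra Lia List Wf_nat Classical ClassicalEpsilon.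
From Stdlib Require Import FunctionalExtensionality.
Import ListNotations.
Open Scope R_scope.

(** Write |x| for the word length and (x|y) for the Gromov product based at the identity.
    From b, walk towards the identity: from a position of length > n jump to a uniformly chosen
    almost-geodesic point of length n, for n running down the multiples of a fixed step size.
    Let F b be the law of the final position, which lies in a fixed ball. By hyperbolicity the
    walks from b and b' stay uniformly close below level (b|b'), and then at each step the two
    sets of targets have uniformly bounded size and a common point; Doeblin's argument gives
    |F b - F b'| <= C rho^(b|b') with rho < 1.  The formal coboundary
    c(g)(x) = F (x^-1 g) - F (x^-1) is a cocycle for left translation in the first variable.
    Since (x^-1 g|x^-1) >= |x| - |g|, it is bounded by C_g rho^|x|, which is summable to the
    power p once rho^p beats the exponential growth of the group.  For x on a geodesic from 1
    to g and away from its endpoints, F (x^-1 g) and F (x^-1) have disjoint supports, so the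
    norm of c(g)(x) is bounded below at about |g| points and the action is proper. *)

(** * Finite sums *)

Definition classic_eq_dec {A : Type} (x y : A) : {x = y} + {x <> y} :=
  excluded_middle_informative (x = y).

Definition decb (P : Prop) : bool :=
  if excluded_middle_informative P then true else false.

Lemma decb_true (P : Prop) : decb P = true <-> P.
Proof.
  unfold decb; destruct (excluded_middle_informative P); split; easy.
Qed.

Section FiniteSums.
Context {A : Type}.
Implicit Types (f g : A -> R) (l : list A).

Lemma sum_list_le f g l :
  (forall x, In x l -> f x <= g x) -> sum_list f l <= sum_list g l.
Proof.
  induction l as [|a l IH]; simpl; intros H; [lra|].
  apply Rplus_le_compat; auto.
Qed.

Lemma sum_list_ext f g l :
  (forall x, In x l -> f x = g x) -> sum_list f l = sum_list g l.
Proof.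
  intros H; apply Rle_antisym; apply sum_list_le; intros x Hx; rewrite H; auto; lra.
Qed.

Lemma sum_list_const (c : R) l : sum_list (fun _ => c) l = INR (length l) * c.
Proof.
  induction l as [|a l IH]; simpl length; [simpl; ring|].
  rewrite S_INR; simpl sum_list; rewrite IH; ring.
Qed.

Lemma sum_list_add f g l :
  sum_list (fun x => f x + g x) l = sum_list f l + sum_list g l.
Proof. induction l as [|a l IH]; simpl; [ring|rewrite IH; ring]. Qed.

Lemma sum_list_sub f g l :
  sum_list (fun x => f x - g x) l = sum_list f l - sum_list g l.
Proof. induction l as [|a l IH]; simpl; [ring|rewrite IH; ring]. Qed.

Lemma sum_list_scal (c : R) f l :
  sum_list (fun x => c * f x) l = c * sum_list f l.
Proof. induction l as [|a l IH]; simpl; [ring|rewrite IH; ring]. Qed.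

Lemma sum_list_map {B : Type} (u : B -> A) f (l : list B) :
  sum_list f (map u l) = sum_list (fun x => f (u x)) l.
Proof. induction l as [|a l IH]; simpl; [reflexivity|rewrite IH; reflexivity]. Qed.

Lemma sum_list_nonneg f l : (forall x, In x l -> 0 <= f x) -> 0 <= sum_list f l.
Proof.
  induction l as [|a l IH]; simpl; intros H; [lra|].
  apply Rplus_le_le_0_compat; auto.
Qed.

Lemma sum_list_partition (P : A -> bool) f l :
  sum_list f l = sum_list f (filter P l) + sum_list f (filter (fun x => negb (P x)) l).
Proof.
  induction l as [|a l IH]; simpl; [ring|].
  destruct (P a); simpl; rewrite IH; ring.
Qed.

Lemma sum_list_single f l (a : A) :
  NoDup l -> In a l -> (forall x, In x l -> x <> a -> f x = 0) -> sum_list f l = f a.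
Proof.
  induction l as [|b l IH]; simpl; intros Hnd Hin H0; [easy|].
  inversion Hnd as [|? ? Hnb Hnd']; subst.
  destruct Hin as [->|Hin].
  - rewrite (sum_list_ext f (fun _ => 0)).
    + rewrite sum_list_const; ring.
    + intros x Hx; apply H0; auto; intros ->; easy.
  - rewrite IH; auto.
    rewrite (H0 b); [ring|auto|intros ->; easy].
Qed.

Lemma sum_list_ge_term f l (a : A) :
  (forall x, In x l -> 0 <= f x) -> In a l -> f a <= sum_list f l.
Proof.
  induction l as [|b l IH]; simpl; intros Hf; [easy|].
  intros [->|Hin].
  - assert (0 <= sum_list f l) by (apply sum_list_nonneg; auto); lra.
  - assert (0 <= f b) by auto; assert (f a <= sum_list f l) by auto; lra.
Qed.

Lemma sum_list_exists_ge f l (c : R) :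
  0 < c -> c <= sum_list f l -> exists x, In x l /\ c / INR (length l) <= f x.
Proof.
  intros Hc Hs; apply NNPP; intros Hno.
  assert (Hl : 0 < INR (length l)).
  { destruct l; [simpl in Hs; lra|apply lt_0_INR; simpl; lia]. }
  assert (Hx : forall x, In x l -> f x < c / INR (length l)).
  { intros x Hx; apply Rnot_le_lt; intros Hle; apply Hno; eauto. }
  assert (Hlt : sum_list f l < INR (length l) * (c / INR (length l))).
  { rewrite <- sum_list_const.
    clear Hs Hno; generalize dependent (c / INR (length l)); intros e He.
    destruct l as [|a l]; [simpl in Hl; lra|simpl].
    apply Rplus_lt_le_compat; [apply He; simpl; auto|].
    apply sum_list_le; intros x Hx; left; apply He; simpl; auto. }
  replace (INR (length l) * (c / INR (length l))) with c in Hlt by (field; lra).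
  lra.
Qed.

(** * Averages over finite lists and Doeblin's contraction *)

Definition mean f l : R := sum_list f l / INR (length l).

Lemma length_pos l (a : A) : In a l -> 1 <= INR (length l).
Proof. intros Ha; destruct l; [easy|]; apply (le_INR 1); simpl; lia. Qed.

Lemma mean_le f l (a : A) (hi : R) :
  In a l -> (forall x, In x l -> f x <= hi) -> mean f l <= hi.
Proof.
  intros Ha Hf; apply length_pos in Ha; unfold mean.
  apply Rmult_le_reg_r with (INR (length l)); [lra|].
  replace (sum_list f l / INR (length l) * INR (length l)) with (sum_list f l) by (field; lra).
  rewrite Rmult_comm, <- sum_list_const; apply sum_list_le; auto.
Qed.

Lemma mean_opp f l : mean (fun x => - f x) l = - mean f l.
Proof.
  unfold mean; replace (sum_list (fun x => - f x) l) with (- sum_list f l); [unfold Rdiv; ring|].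
  induction l as [|a l IH]; simpl; [ring|rewrite <- IH; ring].
Qed.

Lemma mean_ge f l (a : A) (lo : R) :
  In a l -> (forall x, In x l -> lo <= f x) -> lo <= mean f l.
Proof.
  intros Ha Hf.
  assert (H : mean (fun x => - f x) l <= - lo).
  { apply mean_le with a; auto; intros x Hx; specialize (Hf x Hx); lra. }
  rewrite mean_opp in H; lra.
Qed.

Lemma mean_ext f g l : (forall x, In x l -> f x = g x) -> mean f l = mean g l.
Proof. intros H; unfold mean; rewrite (sum_list_ext f g); auto. Qed.

(** The entry [a] has weight at least [/ N] in the average; since [f a <= hi], lowering its weight
    to [/ N] only raises the bound. *)
Lemma mean_le_weighted f l (a : A) (N hi : R) :
  In a l -> INR (length l) <= N -> (forall x, In x l -> f x <= hi) ->
  mean f l <= f a / N + (1 - / N) * hi.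
Proof.
  intros Ha HN Hf.
  assert (H : hi - f a <= sum_list (fun x => hi - f x) l).
  { apply (sum_list_ge_term (fun x => hi - f x)); auto.
    intros x Hx; specialize (Hf x Hx); lra. }
  rewrite sum_list_sub, sum_list_const in H.
  pose proof (length_pos l a Ha) as Hn; specialize (Hf a Ha).
  unfold mean; set (n := INR (length l)) in *.
  assert (Hinv : / N <= / n) by (apply Rinv_le_contravar; lra).
  assert (H2 : sum_list f l / n <= hi - (hi - f a) * / n).
  { apply Rmult_le_reg_r with n; [lra|].
    replace (sum_list f l / n * n) with (sum_list f l) by (field; lra).
    replace ((hi - (hi - f a) * / n) * n) with (n * hi - (hi - f a)) by (field; lra).
    lra. }
  unfold Rdiv at 2; nra.
Qed.

Lemma mean_ge_weighted f l (a : A) (N lo : R) :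
  In a l -> INR (length l) <= N -> (forall x, In x l -> lo <= f x) ->
  f a / N + (1 - / N) * lo <= mean f l.
Proof.
  intros Ha HN Hf.
  assert (H : mean (fun x => - f x) l <= - f a / N + (1 - / N) * - lo).
  { apply (mean_le_weighted (fun x => - f x)); auto.
    intros x Hx; specialize (Hf x Hx); lra. }
  rewrite mean_opp in H; unfold Rdiv in *; lra.
Qed.

(* Doeblin's argument: the common point [a] carries mass at least [1 / N] in both averages. *)
Lemma mean_sub_le_overlap f l l' (a : A) (N w : R) :
  1 < N -> In a l -> In a l' -> INR (length l) <= N -> INR (length l') <= N ->
  (forall x y, In x l -> In y l' -> f x - f y <= w) ->
  mean f l - mean f l' <= (1 - / N) * w.
Proof.
  intros HN Ha Ha' Hl Hl' Hw.
  assert (HNi : 0 < 1 - / N).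
  { assert (/ N < 1) by (rewrite <- Rinv_1; apply Rinv_lt_contravar; lra); lra. }
  (* Lower bound for [f] on [l']: apply [mean_le_weighted] to [l] with [hi := f y + w] and solve for
     [f y]. *)
  set (lo := (mean f l - f a / N) / (1 - / N) - w).
  assert (H : f a / N + (1 - / N) * lo <= mean f l').
  { apply mean_ge_weighted; auto; intros y Hy.
    assert (H : mean f l <= f a / N + (1 - / N) * (f y + w)).
    { apply mean_le_weighted; auto; intros x Hx; specialize (Hw x y Hx Hy); lra. }
    assert ((mean f l - f a / N) / (1 - / N) <= f y + w); [|unfold lo; lra].
    apply Rmult_le_reg_r with (1 - / N); auto.
    replace ((mean f l - f a / N) / (1 - / N) * (1 - / N)) with (mean f l - f a / N)
      by (field; lra).
    lra. }
  replace ((1 - / N) * lo) with (mean f l - f a / N - (1 - / N) * w) in H.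
  - lra.
  - unfold lo; field; lra.
Qed.

Lemma sum_le_support f (B : list A) (v : R) :
  0 <= v -> (forall x, f x <= v) -> (forall x, ~ In x B -> f x = 0) ->
  sum_le f (INR (length B) * v).
Proof.
  intros Hv Hf H0 l Hnd.
  rewrite (sum_list_partition (fun x => decb (In x B))).
  rewrite (sum_list_ext f (fun _ => 0) (filter (fun x => negb _) l)).
  2:{ intros x Hx; apply filter_In in Hx; destruct Hx as [_ Hx]; apply H0.
      intros Hin; apply decb_true in Hin; rewrite Hin in Hx; easy. }
  rewrite sum_list_const, Rmult_0_r, Rplus_0_r.
  eapply Rle_trans; [apply sum_list_le with (g := fun _ => v); auto|].
  rewrite sum_list_const; apply Rmult_le_compat_r; auto.
  apply le_INR, NoDup_incl_length; [apply NoDup_filter; auto|].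
  intros x Hx; apply filter_In in Hx; apply decb_true; tauto.
Qed.

End FiniteSums.

(** * Word metric *)

Section WordMetric.
Context (G : Group).
Local Notation "x ∗ y" := (gmul G x y) (at level 40, left associativity).
Local Notation "x ⁻" := (ginv G x) (at level 5, format "x ⁻").
Local Notation e := (gone G).

Lemma gmul_Vr (x : G) : x ∗ x⁻ = e.
Proof.
  rewrite <- (gmul_1l G (x ∗ x⁻)), <- (gmul_Vl G x⁻) at 1.
  rewrite <- (gmul_assoc G x⁻⁻), (gmul_assoc G x⁻), gmul_Vl, gmul_1l.
  apply gmul_Vl.
Qed.

Lemma gmul_1r (x : G) : x ∗ e = x.
Proof. rewrite <- (gmul_Vl G x), gmul_assoc, gmul_Vr; apply gmul_1l. Qed.

Lemma gmul_Kl (x y : G) : x⁻ ∗ (x ∗ y) = y.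
Proof. rewrite gmul_assoc, gmul_Vl; apply gmul_1l. Qed.

Lemma gmul_Kr (x y : G) : x ∗ (x⁻ ∗ y) = y.
Proof. rewrite gmul_assoc, gmul_Vr; apply gmul_1l. Qed.

Lemma gmul_inj (x y z : G) : x ∗ y = x ∗ z -> y = z.
Proof. intros H; rewrite <- (gmul_Kl x y), H; apply gmul_Kl. Qed.

Lemma ginv_unique (x y : G) : x ∗ y = e -> y = x⁻.
Proof. intros H; apply (gmul_inj x); rewrite H, gmul_Vr; reflexivity. Qed.

Lemma ginv_inv (x : G) : x⁻⁻ = x.
Proof. symmetry; apply ginv_unique, gmul_Vl. Qed.

Lemma ginv_mul (x y : G) : (x ∗ y)⁻ = y⁻ ∗ x⁻.
Proof.
  symmetry; apply ginv_unique.
  rewrite <- gmul_assoc, gmul_Kr; apply gmul_Vr.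
Qed.

Lemma ginv_1 : e⁻ = e.
Proof. symmetry; apply ginv_unique, gmul_1l. Qed.

Definition gprod (l : list G) : G := fold_right (gmul G) e l.

Lemma gprod_app (l m : list G) : gprod (l ++ m) = gprod l ∗ gprod m.
Proof.
  induction l as [|a l IH]; simpl.
  - symmetry; apply gmul_1l.
  - rewrite <- gmul_assoc; f_equal; exact IH.
Qed.

Context (S : list G) (Hgen : generates S).
Local Notation letter := (fun s : G => In s S \/ In (ginv G s) S).
Local Notation len := (wlen S).

(** Generation provides some admissible [n] and strong induction descends to the least one, so the
    [epsilon] in [wlen] has a genuine witness. *)
Lemma wlen_spec (g : G) :
  wlen_le S g (len g) /\ forall m, wlen_le S g m -> (len g <= m)%nat.
Proof.
  unfold wlen; apply epsilon_spec.
  destruct (Hgen g) as [n Hn].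
  induction n as [n IH] using lt_wf_ind.
  destruct (classic (exists m, (m < n)%nat /\ wlen_le S g m)) as [[m [Hm Hw]]|Hno].
  - exact (IH m Hm Hw).
  - exists n; split; auto; intros m Hm.
    destruct (Nat.le_gt_cases n m); auto; exfalso; eauto.
Qed.

Lemma wlen_word (g : G) :
  exists l, length l = len g /\ Forall letter l /\ gprod l = g.
Proof.
  destruct (wlen_spec g) as [(l & Hl & Hf & Hp) Hmin].
  exists l; split; [|auto].
  apply Nat.le_antisymm; auto; apply Hmin; exists l; auto.
Qed.

Lemma wlen_gprod (l : list G) : Forall letter l -> (len (gprod l) <= length l)%nat.
Proof. intros Hl; apply wlen_spec; exists l; auto. Qed.

Lemma wlen_1 : len e = 0%nat.
Proof. pose proof (wlen_gprod [] (Forall_nil _)); simpl in *; lia. Qed.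

Lemma wlen_mul (x y : G) : (len (x ∗ y) <= len x + len y)%nat.
Proof.
  destruct (wlen_word x) as (l & <- & Hl & <-), (wlen_word y) as (m & <- & Hm & <-).
  rewrite <- gprod_app, <- length_app; apply wlen_gprod, Forall_app; auto.
Qed.

Lemma wlen_inv_le (x : G) : (len x⁻ <= len x)%nat.
Proof.
  destruct (wlen_word x) as (l & <- & Hl & <-).
  induction Hl as [|a l Ha Hl IH]; simpl.
  - rewrite ginv_1, wlen_1; auto.
  - rewrite ginv_mul.
    pose proof (wlen_mul (gprod l)⁻ a⁻).
    assert (len a⁻ <= 1)%nat; [|unfold gprod in *; simpl in *; lia].
    replace a⁻ with (gprod [a⁻]) by apply gmul_1r.
    apply (wlen_gprod [a⁻]); constructor; auto.
    rewrite ginv_inv; tauto.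
Qed.

Lemma wlen_inv (x : G) : len x⁻ = len x.
Proof.
  pose proof (wlen_inv_le x); pose proof (wlen_inv_le x⁻).
  rewrite ginv_inv in *; lia.
Qed.

(** Cut a shortest word after [i] letters: the pieces have length at most [i] and [len g - i], and
    subadditivity forces equality. *)
Lemma geodesic_point (g : G) (i : nat) :
  (i <= len g)%nat -> exists x, len x = i /\ (len (x⁻ ∗ g) = len g - i)%nat.
Proof.
  intros Hi; destruct (wlen_word g) as (l & Hlen & Hl & Hp).
  exists (gprod (firstn i l)).
  assert (Heq : gprod (firstn i l) ∗ gprod (skipn i l) = g)
    by (rewrite <- gprod_app, firstn_skipn; auto).
  assert (Hlt : Forall letter (firstn i l) /\ Forall letter (skipn i l))
    by (apply Forall_app; rewrite firstn_skipn; auto).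
  destruct Hlt as [H1 H2].
  apply wlen_gprod in H1, H2.
  rewrite length_firstn in H1; rewrite length_skipn in H2.
  pose proof (wlen_mul (gprod (firstn i l)) (gprod (skipn i l))) as H3.
  rewrite Heq in H3.
  assert (Hk : (gprod (firstn i l))⁻ ∗ g = gprod (skipn i l))
    by (rewrite <- Heq; apply gmul_Kl).
  rewrite Hk; lia.
Qed.

(** * Balls and exponential growth *)

Definition letters : list G := e :: S ++ map (ginv G) S.

(** Products of exactly [n] letters, repetitions allowed; the identity among [letters] pads shorter
    words. *)
Fixpoint ball (n : nat) : list G :=
  match n with
  | O => [e]
  | Datatypes.S n => map (fun p => fst p ∗ snd p) (list_prod letters (ball n))
  end.

Definition degree : nat := length letters.

Lemma length_ball (n : nat) : length (ball n) = (degree ^ n)%nat.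
Proof.
  induction n as [|n IH]; [reflexivity|].
  cbn [ball]; rewrite length_map, length_prod, IH; reflexivity.
Qed.

Lemma mul_in_ball (a g : G) (n : nat) :
  In a letters -> In g (ball n) -> In (a ∗ g) (ball (Datatypes.S n)).
Proof.
  intros Ha Hg; cbn [ball]; apply in_map_iff; exists (a, g); split; auto.
  apply in_prod; auto.
Qed.

Lemma in_ball (g : G) (n : nat) : (len g <= n)%nat -> In g (ball n).
Proof.
  destruct (wlen_word g) as (l & <- & Hl & <-).
  revert n; induction Hl as [|a l Ha Hl IH]; intros n Hn.
  - induction n as [|n IHn]; [simpl; auto|].
    simpl gprod; rewrite <- (gmul_1l G e); apply mul_in_ball; [simpl; auto|apply IHn; simpl; lia].
  - destruct n as [|n]; simpl in Hn; [lia|].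
    apply mul_in_ball; [|apply IH; lia].
    right; apply in_or_app; destruct Ha as [Ha|Ha]; auto.
    right; rewrite <- (ginv_inv a); apply in_map; auto.
Qed.

Lemma ball_translate (x : G) (l : list G) (n : nat) :
  NoDup l -> (forall y, In y l -> (len (x⁻ ∗ y) <= n)%nat) ->
  (length l <= degree ^ n)%nat.
Proof.
  intros Hnd Hl; rewrite <- length_ball, <- (length_map (gmul G x) (ball n)).
  apply NoDup_incl_length; auto.
  intros y Hy; apply in_map_iff; exists (x⁻ ∗ y); split; [apply gmul_Kr|].
  apply in_ball; auto.
Qed.

(** The sphere of radius [n] has at most [degree ^ n] points, so it contributes at most [(/ 2) ^ n];
    spheres below [n] add up to [2 - 2 * (/ 2) ^ n]. *)
Lemma sum_geometric_wlen (r : R) (l : list G) :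
  0 <= r -> INR degree * r <= / 2 -> NoDup l -> sum_list (fun x => r ^ len x) l <= 2.
Proof.
  intros Hr0 Hr Hl.
  assert (H : forall n m, NoDup m -> (forall x, In x m -> (len x < n)%nat) ->
                sum_list (fun x => r ^ len x) m <= 2 - 2 * (/ 2) ^ n).
  { induction n as [|n IH]; intros m Hnd Hm.
    - destruct m as [|x m]; [simpl; lra|specialize (Hm x (or_introl eq_refl)); lia].
    - rewrite (sum_list_partition (fun x => len x =? n)%nat).
      assert (H1 : sum_list (fun x => r ^ len x) (filter (fun x => len x =? n)%nat m)
                   <= (/ 2) ^ n).
      { rewrite (sum_list_ext _ (fun _ => r ^ n)).
        2:{ intros x Hx; apply filter_In in Hx; destruct Hx as [_ Hx].
            apply Nat.eqb_eq in Hx; rewrite Hx; auto. }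
        rewrite sum_list_const.
        apply Rle_trans with ((INR degree * r) ^ n).
        - rewrite Rpow_mult_distr, <- pow_INR; apply Rmult_le_compat_r; [apply pow_le; auto|].
          apply le_INR, (ball_translate e); [apply NoDup_filter; auto|].
          intros y Hy; apply filter_In in Hy; destruct Hy as [_ Hy].
          apply Nat.eqb_eq in Hy; rewrite ginv_1, gmul_1l; lia.
        - apply pow_incr; split; auto; apply Rmult_le_pos; auto; apply pos_INR. }
      assert (H2 : sum_list (fun x => r ^ len x) (filter (fun x => negb (len x =? n)%nat) m)
                   <= 2 - 2 * (/ 2) ^ n).
      { apply IH; [apply NoDup_filter; auto|].
        intros x Hx; apply filter_In in Hx; destruct Hx as [Hx Hn].
        specialize (Hm x Hx); destruct (Nat.eqb_spec (len x) n); [easy|lia]. }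
      simpl pow; lra. }
  assert (Hb : exists n, forall x, In x l -> (len x < n)%nat).
  { clear Hl; induction l as [|a l [n IH]]; [exists 0%nat; easy|].
    exists (Nat.max n (Datatypes.S (len a))); intros x [<-|Hx]; [lia|specialize (IH x Hx); lia]. }
  destruct Hb as [n Hn]; eapply Rle_trans; [apply (H n l Hl Hn)|].
  assert (0 <= (/ 2) ^ n) by (apply pow_le; lra); lra.
Qed.

Lemma exists_list_bounded (P : G -> Prop) (n : nat) :
  (forall x, P x -> (len x <= n)%nat) -> exists l, NoDup l /\ forall x, In x l <-> P x.
Proof.
  intros HP; exists (nodup classic_eq_dec (filter (fun x => decb (P x)) (ball n))).
  split; [apply NoDup_nodup|].
  intros x; rewrite nodup_In, filter_In, decb_true; split; [tauto|].
  intros Hx; split; auto; apply in_ball; auto.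
Qed.

End WordMetric.

(** * The random walk towards the identity *)

Section RandomWalk.
Context (G : Group) (S : list G) (Hgen : generates S) (h : nat).
Local Notation "x ∗ y" := (gmul G x y) (at level 40, left associativity).
Local Notation "x ⁻" := (ginv G x) (at level 5, format "x ⁻").
Local Notation len := (wlen S).
Local Notation d x y := (wlen S (gmul G (ginv G x) y)).

Context (Hhyp : forall x y z w : G,
  (d x y + d z w <= Nat.max (d x z + d y w) (d x w + d y z) + h)%nat).

Lemma dist_sym (x y : G) : d x y = d y x.
Proof. rewrite <- (wlen_inv G S Hgen (x⁻ ∗ y)), ginv_mul, ginv_inv; reflexivity. Qed.

Lemma dist_1 (x : G) : d (gone G) x = len x.
Proof. rewrite ginv_1, gmul_1l; reflexivity. Qed.

Lemma dist_triangle (x y z : G) : (d x z <= d x y + d y z)%nat.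
Proof.
  replace (x⁻ ∗ z) with ((x⁻ ∗ y) ∗ (y⁻ ∗ z)) by (rewrite <- gmul_assoc, gmul_Kr; auto).
  apply wlen_mul; auto.
Qed.

Lemma dist_triangle_1 (x y : G) : (len x <= len y + d x y)%nat.
Proof. rewrite (dist_sym x y), <- (dist_1 x), <- (dist_1 y); apply dist_triangle. Qed.

(* [(p|q) >= min ((p|r), (r|q)) - h/2] for Gromov products based at the identity. *)
Lemma gromov_product (p q r : G) :
  (len r + d p q <= Nat.max (d p r + len q) (d r q + len p) + h)%nat.
Proof.
  pose proof (Hhyp (gone G) r p q) as H.
  rewrite !dist_1, (dist_sym r p) in H; lia.
Qed.

(** Being larger than [2 * h], a step ensures that a Gromov product short of one level by at most
    [2 * h] still exceeds the next lower level. *)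
Definition step : nat := (2 * h + 1)%nat.

(** Equivalently [|z| = n] and [(z|b) >= n - h/2]. The slack is what one use of [gromov_product]
    costs. *)
Definition in_shadow (n : nat) (b z : G) : Prop :=
  len z = n /\ (d z b + n <= len b + h)%nat.

Definition shadow (n : nat) (b : G) : list G :=
  epsilon (inhabits []) (fun l => NoDup l /\ forall z, In z l <-> in_shadow n b z).

Lemma shadow_spec (n : nat) (b : G) :
  NoDup (shadow n b) /\ forall z, In z (shadow n b) <-> in_shadow n b z.
Proof.
  unfold shadow; apply epsilon_spec, (exists_list_bounded G S Hgen _ n).
  intros x [Hx _]; lia.
Qed.

Lemma geodesic_in_shadow (n : nat) (b : G) :
  (n <= len b)%nat -> exists z, In z (shadow n b) /\ (d z b + n = len b)%nat.
Proof.
  intros Hn; destruct (geodesic_point G S Hgen b n Hn) as (z & Hz & Hd).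
  exists z; split; [apply shadow_spec; split|]; lia.
Qed.

(** The [+ 1] keeps this above 1, hence [rate] positive, even when [h = 0]. *)
Definition max_shadow : nat := (degree G S ^ (2 * h) + 1)%nat.

(** Two points of a shadow have Gromov product at least [n - h], so they are at distance at most
    [2 * h]: the shadow fits in a translated ball. *)
Lemma length_shadow (n : nat) (b z : G) :
  In z (shadow n b) -> (n <= len b)%nat -> (length (shadow n b) <= max_shadow)%nat.
Proof.
  intros Hz Hn; unfold max_shadow.
  assert (length (shadow n b) <= degree G S ^ (2 * h))%nat; [|lia].
  apply (ball_translate G S Hgen z); [apply shadow_spec|].
  intros y Hy; apply shadow_spec in Hy, Hz; destruct Hy, Hz.
  pose proof (gromov_product z y b); rewrite (dist_sym b y) in *; lia.
Qed.

(** The expectation of [phi] at the end of the walk from [b] that jumps to the levels [step * k],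
    ..., [step]. *)
Fixpoint walk (phi : G -> R) (k : nat) (b : G) : R :=
  match k with
  | O => phi b
  | Datatypes.S k => mean (walk phi k) (shadow (step * (k + 1)) b)
  end.

(* Every position [z] of the walk started at [b0] satisfies [(z|b0) >= |z| - h]:
   each step is long enough to absorb the error made before it. *)
Lemma walk_localized (phi : G -> R) (b0 : G) (j : nat) (P : R -> Prop) :
  (forall f l (a : G), In a l -> (forall x, In x l -> P (f x)) -> P (mean f l)) ->
  (forall z, (step * (j + 1) <= len z)%nat -> (d z b0 + len z <= len b0 + 2 * h)%nat ->
     P (walk phi j z)) ->
  forall k y, (j <= k)%nat -> (step * (k + 1) <= len y)%nat ->
    (d y b0 + len y <= len b0 + 2 * h)%nat -> P (walk phi k y).
Proof.
  intros Hmean Hj k; induction k as [|k IH]; intros y Hk Hy Hyb.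
  - replace j with 0%nat in * by lia; auto.
  - destruct (Nat.eq_dec j (Datatypes.S k)) as [->|Hne]; [auto|].
    simpl walk.
    destruct (geodesic_in_shadow (step * (k + 1)) y) as (a & Ha & _); [lia|].
    apply Hmean with a; auto.
    intros z Hz; apply shadow_spec in Hz; destruct Hz as [Hz1 Hz2].
    apply IH; [lia|lia|].
    pose proof (gromov_product z b0 y); unfold step in *; lia.
Qed.

Definition rate : R := 1 - / INR max_shadow.

Lemma max_shadow_gt_1 : 1 < INR max_shadow.
Proof.
  apply (lt_INR 1); unfold max_shadow.
  assert (degree G S ^ (2 * h) <> 0)%nat; [|lia].
  apply Nat.pow_nonzero; unfold degree, letters; simpl; lia.
Qed.

Lemma rate_bounds : 0 < rate < 1.
Proof.
  pose proof max_shadow_gt_1 as H; unfold rate.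
  assert (/ INR max_shadow < 1) by (rewrite <- Rinv_1; apply Rinv_lt_contravar; lra).
  assert (0 < / INR max_shadow) by (apply Rinv_0_lt_compat; lra); lra.
Qed.

(** The last hypothesis reads [(y|y') >= step * (j + 1) - 2 * h]. Each jump gains one Doeblin
    factor: the two shadows share a point, and every pair of targets satisfies the hypothesis again
    one level down. *)
Lemma walk_contracts (phi : G -> R) :
  (forall x, 0 <= phi x <= 1) ->
  forall j y y', (step * (j + 1) <= len y)%nat -> (step * (j + 1) <= len y')%nat ->
    (d y y' + 2 * (step * (j + 1)) <= len y + len y' + 4 * h)%nat ->
    walk phi j y - walk phi j y' <= rate ^ j.
Proof.
  intros Hphi j; induction j as [|j IH]; intros y y' Hy Hy' Hd.
  - simpl; pose proof (Hphi y); pose proof (Hphi y'); lra.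
  - simpl walk; simpl pow.
    destruct (geodesic_in_shadow (step * (j + 1)) y) as (a & Ha & Hay); [lia|].
    (* As [(y|y')] exceeds the level of [a], passing from [y] to [y'] costs only [h/2], the slack of
       a shadow. *)
    assert (Ha' : In a (shadow (step * (j + 1)) y')).
    { apply shadow_spec; apply shadow_spec in Ha; destruct Ha as [Ha _]; split; auto.
      pose proof (gromov_product a y' y); unfold step in *; lia. }
    apply mean_sub_le_overlap with a; auto.
    + apply max_shadow_gt_1.
    + apply le_INR; apply length_shadow with a; auto; lia.
    + apply le_INR; apply length_shadow with a; auto; lia.
    + intros z z' Hz Hz'; apply shadow_spec in Hz, Hz'.
      destruct Hz as [Hz Hzy], Hz' as [Hz' Hzy'].
      apply IH; [lia|lia|].
      (* Going from [z] through [y] and [y'] to [z'] loses [h/2] for the shadows and [h/2] for each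
         inequality, less than [2 * h] in all. *)
      pose proof (gromov_product z z' y); pose proof (gromov_product y z' y').
      rewrite (dist_sym y' z') in *; unfold step in *; lia.
Qed.

(** * The law of the final position *)

Definition stage (b : G) : nat := (len b / step - 1)%nat.

(** Hence a first jump, to level [step * stage b], descends by at least [step], as [walk_localized]
    requires. Elements shorter than [2 * step] have stage 0 and stay put. *)
Lemma stage_bound (b : G) : (step <= len b)%nat ->
  (step * (stage b + 1) <= len b < step * (stage b + 2))%nat.
Proof.
  intros Hb; unfold stage.
  assert (Hs : step <> 0%nat) by (unfold step; lia).
  pose proof (Nat.div_mod_eq (len b) step); pose proof (Nat.mod_upper_bound (len b) step Hs).
  pose proof (Nat.div_le_lower_bound (len b) step 1 Hs); nia.
Qed.

(** The mass of the law [F b] at [y]. *)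
Definition hit (b y : G) : R := walk (fun z => if classic_eq_dec z y then 1 else 0) (stage b) b.

(** The distance hypothesis says [(b|b') >= step * (j + 1)]: both walks first descend to stage [j],
    and from there they contract. *)
Lemma walk_diff (phi : G -> R) (b b' : G) (j : nat) :
  (forall x, 0 <= phi x <= 1) ->
  (d b b' + 2 * (step * (j + 1)) <= len b + len b')%nat ->
  walk phi (stage b) b - walk phi (stage b') b' <= rate ^ j.
Proof.
  intros Hphi Hd.
  pose proof (dist_triangle_1 b b'); pose proof (dist_triangle_1 b' b).
  rewrite (dist_sym b' b) in *.
  assert (Hb : (step * (j + 1) <= len b)%nat) by lia.
  assert (Hb' : (step * (j + 1) <= len b')%nat) by lia.
  assert (Hs : (step <= step * (j + 1))%nat) by nia.
  pose proof (stage_bound b ltac:(lia)); pose proof (stage_bound b' ltac:(lia)).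
  assert (Hrefl : forall x, d x x = 0%nat)
    by (intros x; rewrite gmul_Vl; apply wlen_1; auto).
  (* Upper and lower bounds survive averaging, so each walk in turn can be replaced by its positions
     at stage [j]. *)
  apply (walk_localized phi b j (fun t => t - walk phi (stage b') b' <= rate ^ j)).
  - intros f l a Ha Hf.
    assert (mean f l <= walk phi (stage b') b' + rate ^ j); [|lra].
    apply mean_le with a; auto; intros x Hx; specialize (Hf x Hx); lra.
  - intros z Hz Hzb.
    apply (walk_localized phi b' j (fun t => walk phi j z - t <= rate ^ j)).
    + intros f l a Ha Hf.
      assert (walk phi j z - rate ^ j <= mean f l); [|lra].
      apply mean_ge with a; auto; intros x Hx; specialize (Hf x Hx); lra.
    + intros z' Hz' Hzb'; apply walk_contracts; auto.
      (* Localization costs [h] and the two inequalities [h/2] each: this is the [2 * h] allowed in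
         [walk_contracts]. *)
      pose proof (gromov_product z z' b); pose proof (gromov_product b z' b').
      rewrite (dist_sym b' z') in *; unfold step in *; lia.
    + nia.
    + lia.
    + rewrite Hrefl; lia.
  - nia.
  - lia.
  - rewrite Hrefl; lia.
Qed.

Lemma hit_diff (b b' y : G) (j : nat) :
  (d b b' + 2 * (step * (j + 1)) <= len b + len b')%nat ->
  Rabs (hit b y - hit b' y) <= rate ^ j.
Proof.
  intros Hd; unfold hit.
  assert (Hphi : forall x, 0 <= (if classic_eq_dec x y then 1 else 0) <= 1)
    by (intros x; destruct (classic_eq_dec x y); lra).
  apply Rabs_le; split.
  - assert (H := walk_diff _ b' b j Hphi); rewrite dist_sym in H.
    specialize (H ltac:(lia)); lra.
  - apply walk_diff; auto.
Qed.

Lemma walk_bounds (phi : G -> R) (k : nat) (b : G) :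
  (forall x, 0 <= phi x <= 1) -> 0 <= walk phi k b <= 1.
Proof.
  intros Hphi; revert b; induction k as [|k IH]; intros b; simpl walk; [auto|].
  destruct (shadow (step * (k + 1)) b) as [|a l].
  (* The average over an empty shadow is 0, its numerator being 0. *)
  - unfold mean, Rdiv; simpl; rewrite Rmult_0_l; lra.
  - split; [apply mean_ge with a|apply mean_le with a]; try (left; reflexivity);
      intros x _; apply IH.
Qed.

Lemma hit_diff_le_1 (b b' y : G) : Rabs (hit b y - hit b' y) <= 1.
Proof.
  assert (Hphi : forall x, 0 <= (if classic_eq_dec x y then 1 else 0) <= 1)
    by (intros x; destruct (classic_eq_dec x y); lra).
  pose proof (walk_bounds _ (stage b) b Hphi); pose proof (walk_bounds _ (stage b') b' Hphi).
  unfold hit; apply Rabs_le; lra.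
Qed.

(** The [step]-th root turns a factor per jump into a factor per unit of length. *)
Definition decay : R := Rpower rate (/ INR step).

Lemma decay_pow_step : decay ^ step = rate.
Proof.
  pose proof rate_bounds.
  assert (0 < INR step) by (apply lt_0_INR; unfold step; lia).
  rewrite <- Rpower_pow by apply exp_pos.
  unfold decay; rewrite Rpower_mult, Rinv_l, Rpower_1; lra.
Qed.

Lemma decay_bounds : 0 < decay < 1.
Proof.
  split; [apply exp_pos|].
  pose proof rate_bounds; apply Rnot_le_lt; intros Hle.
  apply pow_R1_Rle with (k := step) in Hle; rewrite decay_pow_step in Hle; lra.
Qed.

Lemma hit_decay (g : G) :
  exists M, 0 < M /\ forall x y, Rabs (hit (x⁻ ∗ g) y - hit x⁻ y) <= M * decay ^ len x.
Proof.
  pose proof decay_bounds as Hd; set (r := (len g + 2 * step)%nat).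
  (* The shift [r] pays for the loss [|g|] in the Gromov product and for less than [2 * step] lost
     in rounding. For [len x <= r] the trivial bound 1 suffices. *)
  exists (/ decay ^ r); split; [apply Rinv_0_lt_compat, pow_lt; lra|].
  assert (Hr : forall n m, (m <= n + r)%nat -> decay ^ n <= / decay ^ r * decay ^ m).
  { intros n m Hm; assert (Hp : 0 < decay ^ r) by (apply pow_lt; lra).
    apply Rmult_le_reg_l with (decay ^ r); auto.
    rewrite <- Rmult_assoc, Rinv_r, Rmult_1_l by lra.
    rewrite <- pow_add; replace (r + n)%nat with (m + (r + n - m))%nat by lia.
    rewrite pow_add.
    rewrite <- (Rmult_1_r (decay ^ m)) at 2; apply Rmult_le_compat_l; [apply pow_le; lra|].
    rewrite <- (pow1 (r + n - m)); apply pow_incr; lra. }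
  intros x y.
  destruct (Nat.le_gt_cases (len x) r) as [Hx|Hx].
  - eapply Rle_trans; [apply hit_diff_le_1|apply (Hr 0%nat); lia].
  - assert (Hs : step <> 0%nat) by (unfold step; lia).
    (* The largest [j] with [step * (j + 1) <= |x| - |g|], a lower bound for the Gromov product. *)
    set (j := ((len x - len g) / step - 1)%nat).
    assert (Hj : (step * (j + 1) <= len x - len g < step * (j + 2))%nat).
    { unfold j; pose proof (Nat.div_mod_eq (len x - len g) step).
      pose proof (Nat.mod_upper_bound (len x - len g) step Hs).
      pose proof (Nat.div_le_lower_bound (len x - len g) step 1 Hs); nia. }
    apply Rle_trans with (rate ^ j).
    + apply hit_diff.
      rewrite ginv_mul, ginv_inv, <- gmul_assoc, gmul_Vr, gmul_1r, !(wlen_inv G S Hgen).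
      pose proof (wlen_mul G S Hgen (x⁻ ∗ g) g⁻) as H.
      rewrite <- gmul_assoc, gmul_Vr, gmul_1r, !(wlen_inv G S Hgen) in H; lia.
    + rewrite <- decay_pow_step, <- pow_mult; apply Hr; unfold r; nia.
Qed.

(** The last jump lands at length [step], and a walk without jumps ends where it starts; values of
    [phi] elsewhere are never read. *)
Lemma walk_local (phi psi : G -> R) :
  (forall x, (len x <= 2 * step)%nat -> phi x = psi x) ->
  forall k b, (k = 0%nat -> (len b <= 2 * step)%nat) -> walk phi k b = walk psi k b.
Proof.
  intros Hx k; induction k as [|k IH]; intros b Hb; simpl walk; [auto|].
  apply mean_ext; intros z Hz; apply shadow_spec in Hz; destruct Hz as [Hz _].
  apply IH; intros ->; lia.
Qed.

Lemma stage_0 (b : G) : stage b = 0%nat -> (len b <= 2 * step)%nat.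
Proof.
  intros H; destruct (Nat.le_gt_cases step (len b)) as [Hb|Hb]; [|lia].
  pose proof (stage_bound b Hb); rewrite H in *; lia.
Qed.

Lemma walk_sum (l : list G) (c : G -> R) (phi : G -> G -> R) (k : nat) (b : G) :
  walk (fun z => sum_list (fun y => c y * phi y z) l) k b
  = sum_list (fun y => c y * walk (phi y) k b) l.
Proof.
  revert b; induction k as [|k IH]; intros b; simpl walk; [reflexivity|].
  erewrite mean_ext by (intros; apply IH).
  unfold mean; clear IH; generalize (shadow (step * (k + 1)) b); intros m.
  induction l as [|y l IHl]; simpl.
  - rewrite sum_list_const; unfold Rdiv; ring.
  - rewrite sum_list_add, sum_list_scal, Rdiv_plus_distr, IHl; unfold Rdiv; ring.
Qed.

Lemma hit_support (b y : G) : (2 * step < len y)%nat -> hit b y = 0.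
Proof.
  intros Hy; unfold hit.
  (* Zero is written as an empty sum so that [walk_sum] with [l = []] evaluates the walk. *)
  rewrite (walk_local _ (fun _ => sum_list (fun _ : G => 0 * 0) [])).
  - rewrite (walk_sum [] (fun _ => 0) (fun _ _ => 0)); reflexivity.
  - intros x Hx; destruct (classic_eq_dec x y) as [->|]; [lia|reflexivity].
  - apply stage_0.
Qed.

(** Expand [phi] on the ball into point indicators and use linearity; this passes from test
    functions to coordinates. *)
Lemma hit_walk (phi : G -> R) (b : G) (B : list G) :
  NoDup B -> (forall x, In x B <-> (len x <= 2 * step)%nat) ->
  walk phi (stage b) b = sum_list (fun y => phi y * hit b y) B.
Proof.
  intros Hnd HB; unfold hit.
  rewrite <- (walk_sum B phi (fun y z => if classic_eq_dec z y then 1 else 0)).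
  apply walk_local; [|apply stage_0].
  intros x Hx; rewrite (sum_list_single _ _ x); auto.
  - destruct (classic_eq_dec x x); [ring|easy].
  - apply HB; auto.
  - intros z _ Hz; destruct (classic_eq_dec x z); [subst; easy|ring].
Qed.

(* When the identity lies on a geodesic from [b] to [b'], the two walks end in disjoint sets. *)
Lemma hit_separated (b b' : G) (B : list G) :
  NoDup B -> (forall x, In x B <-> (len x <= 2 * step)%nat) ->
  (step <= len b)%nat -> (step <= len b')%nat -> (len b + len b' <= d b b')%nat ->
  exists y, / INR (length B) <= Rabs (hit b y - hit b' y).
Proof.
  intros Hnd HB Hb Hb' Hd.
  pose proof (stage_bound b Hb) as Hsb; pose proof (stage_bound b' Hb') as Hsb'.
  assert (Hrefl : forall x, d x x = 0%nat)
    by (intros x; rewrite gmul_Vl; apply wlen_1; auto).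
  (* Indicator of the region to which [walk_localized] confines the walk from [b]. *)
  set (phi := fun z => if decb (d z b + len z <= len b + 2 * h)%nat then 1 else 0).
  assert (Hmean : forall t f l (a : G), In a l -> (forall x, In x l -> f x = t) -> mean f l = t).
  { intros t f l a Ha Hf; apply Rle_antisym.
    - apply mean_le with a; auto; intros x Hx; rewrite Hf; auto; lra.
    - apply mean_ge with a; auto; intros x Hx; rewrite Hf; auto; lra. }
  assert (H1 : walk phi (stage b) b = 1).
  { apply (walk_localized phi b 0 (fun t => t = 1)); [apply Hmean| |lia|lia|rewrite Hrefl; lia].
    intros z _ Hz; simpl; unfold phi; apply decb_true in Hz; rewrite Hz; auto. }
  assert (H2 : walk phi (stage b') b' = 0).
  { apply (walk_localized phi b' 0 (fun t => t = 0)); [apply Hmean| |lia|lia|rewrite Hrefl; lia].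
    intros z Hz1 Hz; simpl; unfold phi.
    destruct (decb _) eqn:Hdec; [exfalso|auto].
    apply (proj1 (decb_true _)) in Hdec.
    (* A common end [z] would give [d b b' <= |b| + |b'| + 4 * h - 2 * |z|], impossible since
       [|z| >= step > 2 * h]. *)
    pose proof (dist_triangle b z b'); rewrite (dist_sym b z) in *; unfold step in *; lia. }
  rewrite (hit_walk phi b B Hnd HB) in H1; rewrite (hit_walk phi b' B Hnd HB) in H2.
  (* The two expectations of [phi] differ by 1, so some point of [B] carries at least the average
     share. *)
  destruct (sum_list_exists_ge (fun y => phi y * (hit b y - hit b' y)) B 1) as (y & Hy & Hge).
  - lra.
  - rewrite (sum_list_ext _ (fun y => phi y * hit b y - phi y * hit b' y)) by (intros; ring).
    rewrite sum_list_sub; lra.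
  - exists y; eapply Rle_trans; [|eapply Rle_trans; [apply Hge|]].
    + right; field; apply not_0_INR; destruct B; [easy|simpl; lia].
    + unfold phi; pose proof (Rle_abs (hit b y - hit b' y)).
      pose proof (Rabs_pos (hit b y - hit b' y)); destruct (decb _); lra.
Qed.

End RandomWalk.

(** * Gauges *)

(** Completeness applied to the reflected set supplies the witness for [epsilon]. *)
Lemma InfR_spec (E : R -> Prop) (lo : R) :
  (exists x, E x) -> (forall x, E x -> lo <= x) -> is_glb_R E (InfR E).
Proof.
  intros [x Hx] Hlo; unfold InfR; apply epsilon_spec.
  destruct (completeness (fun r => E (- r))) as [m [Hub Hlub]].
  - exists (- lo); intros r Hr; specialize (Hlo _ Hr); lra.
  - exists (- x); rewrite Ropp_involutive; auto.
  - exists (- m); split.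
    + intros z Hz; assert (- z <= m); [|lra].
      apply Hub; rewrite Ropp_involutive; auto.
    + intros r Hr; assert (m <= - r); [|lra].
      apply Hlub; intros z Hz; specialize (Hr _ Hz); lra.
Qed.

Lemma is_glb_R_unique (E E' : R -> Prop) (r r' : R) :
  (forall x, E x <-> E' x) -> is_glb_R E r -> is_glb_R E' r' -> r = r'.
Proof.
  intros HE [H1 H2] [H1' H2']; apply Rle_antisym.
  - apply H2'; intros x Hx; apply H1, HE, Hx.
  - apply H2; intros x Hx; apply H1', HE, Hx.
Qed.

Section Gauge.
Context (Phi : R -> R) (HPhi : N_function Phi).

Lemma N_convex (x y t : R) : 0 <= x -> 0 <= y -> 0 <= t <= 1 ->
  Phi (t * x + (1 - t) * y) <= t * Phi x + (1 - t) * Phi y.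
Proof. apply HPhi. Qed.

Lemma N_zero : Phi 0 = 0.
Proof. apply HPhi. Qed.

Lemma N_pos (t : R) : 0 < t -> 0 < Phi t.
Proof. apply HPhi. Qed.

Lemma N_nonneg (t : R) : 0 <= t -> 0 <= Phi t.
Proof. intros [Ht| <-]; [left; apply N_pos; auto|rewrite N_zero; lra]. Qed.

Lemma N_scale (a t : R) : 0 <= a <= 1 -> 0 <= t -> Phi (a * t) <= a * Phi t.
Proof.
  intros Ha Ht; pose proof (N_convex t 0 a Ht (Rle_refl 0) Ha) as H.
  rewrite N_zero, !Rmult_0_r, !Rplus_0_r in H; auto.
Qed.

Lemma N_mono (s t : R) : 0 <= s <= t -> Phi s <= Phi t.
Proof.
  intros [Hs [Hst| ->]]; [|lra].
  replace s with (s / t * t) by (field; lra).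
  assert (Ha : 0 <= s / t <= 1).
  { split; [apply Rle_mult_inv_pos; lra|].
    apply Rmult_le_reg_r with t; [lra|]; replace (s / t * t) with s by (field; lra); lra. }
  pose proof (N_scale (s / t) t Ha ltac:(lra)); pose proof (N_nonneg t ltac:(lra)); nra.
Qed.

Lemma N_small (eps : R) : 0 < eps -> exists s, 0 < s /\ Phi s <= eps.
Proof.
  intros He; destruct HPhi as (_ & _ & _ & H & _).
  destruct (H eps He) as (d & Hd & Hs).
  assert (Hm : 0 < Rmin (d / 2) 1) by (apply Rmin_pos; lra).
  pose proof (Rmin_l (d / 2) 1); pose proof (Rmin_r (d / 2) 1).
  set (s := Rmin (d / 2) 1) in *; exists s; split; auto.
  assert (Hlt : Phi s / s < eps) by (apply Hs; lra).
  apply Rmult_lt_compat_r with (r := s) in Hlt; auto.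
  replace (Phi s / s * s) with (Phi s) in Hlt by (field; lra); nra.
Qed.

Lemma N_large : exists T, 0 < T /\ forall t, T < t -> 1 < Phi t.
Proof.
  destruct HPhi as (_ & _ & _ & _ & H).
  destruct (H 1) as (T & HT & Hs).
  pose proof (Rmax_l T 1); pose proof (Rmax_r T 1).
  exists (Rmax T 1); split; [lra|]; intros t Ht.
  assert (Hlt : 1 < Phi t / t) by (apply Hs; lra).
  apply Rmult_lt_compat_r with (r := t) in Hlt; [|lra].
  replace (Phi t / t * t) with (Phi t) in Hlt by (field; lra); lra.
Qed.

(** * Gauges of nonnegative families *)

Section Modular.
Context {A : Type}.
Implicit Types (u v w : A -> R).

(* [gauge] and [gaugePsiPhi] are both definitionally instances of [mgauge]. *)
Definition mfinite u : Prop := exists a, 0 < a /\ sum_finite (fun x => Phi (a * u x)).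
Definition unit_scale u (b : R) : Prop := 0 < b /\ sum_le (fun x => Phi (u x / b)) 1.
Definition mgauge u : R := InfR (unit_scale u).

(** Dividing the argument by [M' >= 1] divides the modular by at least [M'], by convexity and
    [Phi 0 = 0]. *)
Lemma unit_scale_exists u : (forall x, 0 <= u x) -> mfinite u -> exists b, unit_scale u b.
Proof.
  intros Hu (a & Ha & M & HM).
  set (M' := Rmax M 1); pose proof (Rmax_l M 1 : M <= M'); pose proof (Rmax_r M 1 : 1 <= M').
  exists (M' / a); split; [apply Rdiv_lt_0_compat; lra|].
  intros l Hl.
  apply Rle_trans with (sum_list (fun x => / M' * Phi (a * u x)) l).
  - apply sum_list_le; intros x _.
    replace (u x / (M' / a)) with (/ M' * (a * u x)) by (field; lra).
    apply N_scale; [|apply Rmult_le_pos; auto; lra].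
    split; [left; apply Rinv_0_lt_compat; lra|].
    rewrite <- Rinv_1; apply Rinv_le_contravar; lra.
  - rewrite sum_list_scal; specialize (HM l Hl).
    apply Rmult_le_reg_l with M'; [lra|].
    rewrite <- Rmult_assoc, Rinv_r, Rmult_1_l by lra; lra.
Qed.

Lemma mgauge_glb u :
  (forall x, 0 <= u x) -> mfinite u -> is_glb_R (unit_scale u) (mgauge u).
Proof.
  intros Hu Hf; apply InfR_spec with 0; [apply unit_scale_exists; auto|].
  intros b [Hb _]; lra.
Qed.

Lemma mgauge_nonneg u : (forall x, 0 <= u x) -> mfinite u -> 0 <= mgauge u.
Proof.
  intros Hu Hf; apply (mgauge_glb u Hu Hf); intros b [Hb _]; lra.
Qed.

(** Unit scales are upward closed because [Phi] is monotone. *)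
Lemma unit_scale_gt_mgauge u (b : R) :
  (forall x, 0 <= u x) -> mfinite u -> mgauge u < b -> unit_scale u b.
Proof.
  intros Hu Hf Hb.
  destruct (classic (exists b', unit_scale u b' /\ b' <= b)) as [(b' & [Hb' Hs] & Hle)|Hno].
  - split; [lra|]; intros l Hl; eapply Rle_trans; [|apply (Hs l Hl)].
    apply sum_list_le; intros x _; apply N_mono; split.
    + apply Rle_mult_inv_pos; auto; lra.
    + apply Rmult_le_compat_l; auto; apply Rinv_le_contravar; auto.
  - exfalso; apply Rlt_not_le in Hb; apply Hb, (mgauge_glb u Hu Hf).
    intros b' Hb'; apply Rnot_lt_le; intros Hlt; apply Hno; exists b'; split; auto; lra.
Qed.

(** In a unit scale [b] the single term [Phi (u x / b)] is at most 1, which forces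
    [u x / b <= T]. *)
Lemma mgauge_ge (T : R) u (x : A) :
  0 < T -> (forall t, T < t -> 1 < Phi t) -> (forall x, 0 <= u x) -> mfinite u ->
  u x / T <= mgauge u.
Proof.
  intros HT HPT Hu Hf; apply (mgauge_glb u Hu Hf); intros b [Hb Hs].
  assert (Hle : u x / b <= T).
  { apply Rnot_lt_le; intros Hlt; apply HPT in Hlt.
    assert (NoDup [x]) by (constructor; [easy|constructor]).
    specialize (Hs [x] H); simpl in Hs; lra. }
  apply Rmult_le_reg_r with T; auto; replace (u x / T * T) with (u x) by (field; lra).
  apply Rmult_le_compat_r with (r := b) in Hle; [|lra].
  replace (u x / b * b) with (u x) in Hle by (field; lra); lra.
Qed.

Lemma mfinite_support u (B : list A) (v : R) :
  (forall x, 0 <= u x <= v) -> (forall x, ~ In x B -> u x = 0) -> mfinite u.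
Proof.
  intros Hu H0; exists 1; split; [lra|].
  exists (INR (length B) * Phi (Rabs v)); apply sum_le_support.
  - apply N_nonneg, Rabs_pos.
  - intros x; apply N_mono; pose proof (Hu x); pose proof (Rle_abs v); lra.
  - intros x Hx; rewrite H0, Rmult_0_r; auto; apply N_zero.
Qed.

(** At scale [v / s] each term is at most [Phi s], and at most [length B] points contribute. *)
Lemma mgauge_le_support u (B : list A) (v s : R) :
  0 < v -> 0 < s -> INR (length B) * Phi s <= 1 ->
  (forall x, 0 <= u x <= v) -> (forall x, ~ In x B -> u x = 0) -> mgauge u <= v / s.
Proof.
  intros Hv Hs HB Hu H0.
  assert (Hvs : 0 < v / s) by (apply Rdiv_lt_0_compat; auto).
  apply (mgauge_glb u (fun x => proj1 (Hu x)) (mfinite_support u B v Hu H0)).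
  split; auto.
  intros l Hl; eapply Rle_trans; [|apply HB]; revert l Hl; apply sum_le_support.
  - apply N_nonneg; lra.
  - intros x; apply N_mono; specialize (Hu x); split; [apply Rle_mult_inv_pos; lra|].
    apply Rmult_le_reg_r with (v / s); auto.
    replace (u x / (v / s) * (v / s)) with (u x) by (field; lra).
    replace (s * (v / s)) with v by (field; lra); lra.
  - intros x Hx; rewrite H0; auto; unfold Rdiv; rewrite Rmult_0_l; apply N_zero.
Qed.

Lemma mfinite_add u v w :
  (forall x, 0 <= u x) -> (forall x, 0 <= v x) -> (forall x, 0 <= w x <= u x + v x) ->
  mfinite u -> mfinite v -> mfinite w.
Proof.
  intros Hu Hv Hw (a & Ha & M & HM) (a' & Ha' & M' & HM').
  assert (Hmin : 0 < Rmin a a') by (apply Rmin_pos; auto).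
  pose proof (Rmin_l a a'); pose proof (Rmin_r a a'); set (m := Rmin a a') in *.
  (* With this factor the argument is at most the midpoint of [a * u x] and [a' * v x], and
     convexity applies. *)
  exists (m / 2); split; [lra|].
  exists (M + M'); intros l Hl.
  eapply Rle_trans; [|apply Rplus_le_compat; [apply (HM l Hl)|apply (HM' l Hl)]].
  rewrite <- sum_list_add; apply sum_list_le; intros x _.
  specialize (Hu x); specialize (Hv x); specialize (Hw x).
  assert (Hau : 0 <= a * u x) by nra; assert (Hav : 0 <= a' * v x) by nra.
  apply Rle_trans with (Phi (/ 2 * (a * u x) + (1 - / 2) * (a' * v x))).
  - apply N_mono; nra.
  - pose proof (N_convex (a * u x) (a' * v x) (/ 2) Hau Hav ltac:(lra)).
    pose proof (N_nonneg _ Hau); pose proof (N_nonneg _ Hav); lra.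
Qed.

Lemma mgauge_triangle u v w :
  (forall x, 0 <= u x) -> (forall x, 0 <= v x) -> (forall x, 0 <= w x <= u x + v x) ->
  mfinite u -> mfinite v -> mgauge w <= mgauge u + mgauge v.
Proof.
  intros Hu Hv Hw Hfu Hfv; apply Rnot_lt_le; intros Hlt.
  (* A quarter of the supposed gap: enlarging both gauges by [eps] still leaves their sum below
     [mgauge w]. *)
  set (eps := (mgauge w - (mgauge u + mgauge v)) / 4).
  assert (He : 0 < eps) by (unfold eps; lra).
  pose proof (mgauge_nonneg u Hu Hfu); pose proof (mgauge_nonneg v Hv Hfv).
  assert (Hw' : mfinite w) by (apply mfinite_add with u v; auto).
  destruct (unit_scale_gt_mgauge u (mgauge u + eps) Hu Hfu ltac:(lra)) as [Hp Hsu].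
  destruct (unit_scale_gt_mgauge v (mgauge v + eps) Hv Hfv ltac:(lra)) as [Hq Hsv].
  set (p := mgauge u + eps) in *; set (q := mgauge v + eps) in *.
  assert (Hle : mgauge w <= p + q); [|unfold p, q, eps in *; lra].
  apply (mgauge_glb w (fun x => proj1 (Hw x)) Hw'); split; [lra|].
  (* The weight that makes [(u x + v x) / (p + q)] a convex combination of [u x / p] and
     [v x / q]. *)
  set (t := p / (p + q)).
  assert (Ht : 0 <= t <= 1).
  { unfold t; split; [apply Rle_mult_inv_pos; lra|].
    apply Rmult_le_reg_r with (p + q); [lra|].
    replace (p / (p + q) * (p + q)) with p by (field; lra); lra. }
  intros l Hl.
  apply Rle_trans with (sum_list (fun x => t * Phi (u x / p) + (1 - t) * Phi (v x / q)) l).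
  - apply sum_list_le; intros x _.
    specialize (Hu x); specialize (Hv x); specialize (Hw x).
    eapply Rle_trans; [|apply N_convex; auto; apply Rle_mult_inv_pos; lra].
    replace (t * (u x / p) + (1 - t) * (v x / q)) with ((u x + v x) / (p + q))
      by (unfold t; field; lra).
    apply N_mono; split; [apply Rle_mult_inv_pos; lra|].
    apply Rmult_le_compat_r; [left; apply Rinv_0_lt_compat|]; lra.
  - rewrite sum_list_add, !sum_list_scal; specialize (Hsu l Hl); specialize (Hsv l Hl); nra.
Qed.

Lemma sum_le_comp (f : A -> R) (M : R) (s : A -> A) :
  (forall x y, s x = s y -> x = y) -> sum_le f M -> sum_le (fun x => f (s x)) M.
Proof.
  intros Hs Hf l Hl; rewrite <- sum_list_map; apply Hf.
  apply NoDup_map_NoDup_ForallPairs; auto; intros x y _ _; apply Hs.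
Qed.

Lemma mfinite_comp u (s : A -> A) :
  (forall x y, s x = s y -> x = y) -> mfinite u -> mfinite (fun x => u (s x)).
Proof.
  intros Hs (a & Ha & M & HM); exists a; split; auto; exists M.
  apply (sum_le_comp (fun x => Phi (a * u x))); auto.
Qed.

Lemma mgauge_comp u (s s' : A -> A) :
  (forall x, s (s' x) = x) -> (forall x, s' (s x) = x) -> (forall x, 0 <= u x) -> mfinite u ->
  mgauge (fun x => u (s x)) = mgauge u.
Proof.
  intros H1 H2 Hu Hf.
  assert (Hs : forall x y, s x = s y -> x = y) by (intros x y E; rewrite <- (H2 x), E; auto).
  assert (Hs' : forall x y, s' x = s' y -> x = y) by (intros x y E; rewrite <- (H1 x), E; auto).
  apply (is_glb_R_unique (unit_scale (fun x => u (s x))) (unit_scale u)).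
  - intros b; split; intros [Hb HM]; split; auto.
    + apply (sum_le_comp _ _ s' Hs') in HM; intros l Hl; specialize (HM l Hl).
      erewrite sum_list_ext; [apply HM|]; intros x _; simpl; rewrite H1; auto.
    + apply (sum_le_comp (fun x => Phi (u x / b))); auto.
  - apply mgauge_glb; auto; apply mfinite_comp; auto.
  - apply mgauge_glb; auto.
Qed.

End Modular.
End Gauge.

(** * The affine action *)

(** The cocycle has real values, so this interface treats both fields at once. [sabs_inj_le] is a
    reverse triangle inequality phrased without negation. *)
Record real_embedding (K : Scalars) (inj : R -> K) : Prop := {
  sabs_inj : forall r, sabs K (inj r) = Rabs r;
  sabs_nonneg : forall z, 0 <= sabs K z;
  sabs_add : forall z w, sabs K (sadd K z w) <= sabs K z + sabs K w;
  sabs_inj_le : forall z r, Rabs r <= sabs K (sadd K z (inj r)) + sabs K z;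
  sadd_inj_0 : forall z, sadd K z (inj 0) = z;
  sadd_inj_add : forall z r s, sadd K (sadd K z (inj r)) (inj s) = sadd K z (inj (r + s))
}.

Lemma real_embedding_R : real_embedding RScalars (fun r => r).
Proof.
  split; simpl; intros.
  - reflexivity.
  - apply Rabs_pos.
  - apply Rabs_triang.
  - replace r with ((z + r) + - z) at 1 by ring.
    rewrite <- (Rabs_Ropp z); apply Rabs_triang.
  - ring.
  - ring.
Qed.

Lemma sabs_C_triangle (z w : CScalars) :
  sabs CScalars (sadd CScalars z w) <= sabs CScalars z + sabs CScalars w.
Proof.
  destruct z as [a b], w as [c d]; simpl.
  pose proof (sqrt_cauchy a b c d) as H; unfold Rsqr in H.
  assert (H1 : 0 <= a * a + b * b) by nra; assert (H2 : 0 <= c * c + d * d) by nra.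
  pose proof (sqrt_pos (a * a + b * b)); pose proof (sqrt_pos (c * c + d * d)).
  apply Rsqr_incr_0_var; [|lra].
  rewrite Rsqr_sqrt by (apply Rplus_le_le_0_compat; apply Rle_0_sqr); unfold Rsqr.
  pose proof (sqrt_sqrt _ H1); pose proof (sqrt_sqrt _ H2); nra.
Qed.

Lemma real_embedding_C : real_embedding CScalars (fun r => (r, 0)).
Proof.
  assert (Habs : forall r, sabs CScalars (r, 0) = Rabs r).
  { intros r; simpl; replace (r * r + 0 * 0) with (Rsqr r) by (unfold Rsqr; ring).
    apply sqrt_Rsqr_abs. }
  split; intros.
  - apply Habs.
  - apply sqrt_pos.
  - apply sabs_C_triangle.
  - rewrite <- Habs; destruct z as [a b].
    pose proof (sabs_C_triangle (sadd CScalars (a, b) (r, 0)) (- a, - b)) as H.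
    replace (sadd CScalars (sadd CScalars (a, b) (r, 0)) (- a, - b)) with (r, 0) in H
      by (simpl; f_equal; ring).
    replace (sabs CScalars (- a, - b)) with (sabs CScalars (a, b)) in H
      by (simpl; f_equal; ring).
    exact H.
  - destruct z; simpl; f_equal; ring.
  - destruct z; simpl; f_equal; ring.
Qed.

(** * Left translation with the coboundary of a kernel [F] having uniform support, decay and
    separation *)

Section Action.
Context (G : Group) (S : list G) (Hgen : generates S).
Local Notation "x ∗ y" := (gmul G x y) (at level 40, left associativity).
Local Notation "x ⁻" := (ginv G x) (at level 5, format "x ⁻").
Local Notation len := (wlen S).
Context (K : Scalars) (inj : R -> K) (HK : real_embedding K inj).
Context (Phi Psi : R -> R) (HPhi : N_function Phi) (HPsi : N_function Psi).
Context (F : G -> G -> R) (B : list G) (rho c p : R) (m : nat).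
Context (HF_support : forall b y, ~ In y B -> F b y = 0).
Context (Hrho : 0 < rho < 1).
Context (HF_decay : forall g, exists M, 0 < M /\
  forall x y, Rabs (F (x⁻ ∗ g) y - F x⁻ y) <= M * rho ^ len x).
Context (Hc : 0 < c).
Context (HF_separated : forall g x, (m <= len x)%nat -> (m <= len (x⁻ ∗ g))%nat ->
  (len x + len (x⁻ ∗ g) = len g)%nat -> exists y, c <= Rabs (F (x⁻ ∗ g) y - F x⁻ y)).
Context (Hp : INR (degree G S) * Rpower rho p <= / 2).
Context (HPsi_p : exists D t0, 0 < D /\ 0 < t0 /\
  forall t, 0 < t <= t0 -> Psi t <= D * Rpower t p).

Local Notation inX := (@in_lPsiPhi G K Psi Phi).

Definition translation (g : G) (xi : G -> G -> K) : G -> G -> K := fun x y => xi (g⁻ ∗ x) y.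
Definition cocycle (g x y : G) : K := inj (F (x⁻ ∗ g) y - F x⁻ y).

Lemma in_lPhi_gauge_nonneg (v : G -> K) : in_lPhi Phi v -> 0 <= gauge Phi v.
Proof. apply (mgauge_nonneg Phi HPhi); intros x; apply (sabs_nonneg K inj HK). Qed.

(** Row [x] lives on [B] with entries at most [M * rho ^ |x|], so its gauge is of that order; the
    power bound on [Psi] then leaves a series in [Rpower rho p ^ |x|], which [Hp] makes summable. *)
Lemma cocycle_inX (g : G) : inX (cocycle g).
Proof.
  destruct (HF_decay g) as (M & HM & Hdec).
  assert (Hb : forall x y, 0 <= sabs K (cocycle g x y) <= M * rho ^ len x).
  { intros x y; unfold cocycle; rewrite (sabs_inj K inj HK); split; [apply Rabs_pos|auto]. }
  assert (H0 : forall x y, ~ In y B -> sabs K (cocycle g x y) = 0).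
  { intros x y Hy; unfold cocycle; rewrite (sabs_inj K inj HK), !HF_support; auto.
    rewrite Rminus_0_r; apply Rabs_R0. }
  assert (Hin : forall x, in_lPhi Phi (cocycle g x)).
  { intros x; exact (mfinite_support Phi HPhi _ B _ (Hb x) (H0 x)). }
  split; auto.
  destruct (N_small Phi HPhi (/ (INR (length B) + 1))) as (s & Hs & HsB).
  { pose proof (pos_INR (length B)); apply Rinv_0_lt_compat; lra. }
  assert (HB : INR (length B) * Phi s <= 1).
  { pose proof (pos_INR (length B)).
    apply Rle_trans with ((INR (length B) + 1) * / (INR (length B) + 1)).
    - apply Rmult_le_compat; try lra; apply (N_nonneg Phi HPhi); lra.
    - rewrite Rinv_r; lra. }
  destruct HPsi_p as (D & t0 & HD & Ht0 & HPt).
  (* This factor brings the gauge of row [x] below [t0 * rho ^ |x| <= t0], within the range of the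
     power bound. *)
  exists (t0 * s / M); split; [apply Rdiv_lt_0_compat; auto; nra|].
  exists (D * Rpower t0 p * 2); intros l Hl.
  apply Rle_trans with (sum_list (fun x => D * Rpower t0 p * Rpower rho p ^ len x) l).
  - apply sum_list_le; intros x _.
    assert (Hr : 0 < rho ^ len x) by (apply pow_lt; lra).
    assert (Hg : gauge Phi (cocycle g x) <= M * rho ^ len x / s).
    { apply (mgauge_le_support Phi HPhi _ B); auto; nra. }
    pose proof (in_lPhi_gauge_nonneg _ (Hin x)) as Hg0.
    apply Rle_trans with (Psi (t0 * rho ^ len x)).
    + apply (N_mono Psi HPsi); split.
      * apply Rmult_le_pos; auto; left; apply Rdiv_lt_0_compat; nra.
      * replace (t0 * rho ^ len x) with (t0 * s / M * (M * rho ^ len x / s)) by (field; lra).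
        apply Rmult_le_compat_l; auto; left; apply Rdiv_lt_0_compat; nra.
    + assert (Hr1 : rho ^ len x <= 1) by (rewrite <- (pow1 (len x)); apply pow_incr; lra).
      eapply Rle_trans; [apply HPt; nra|].
      rewrite <- Rpower_mult_distr by auto.
      rewrite <- (Rpower_pow (len x) rho), Rpower_mult by lra.
      rewrite <- (Rpower_pow (len x)), Rpower_mult by apply exp_pos.
      rewrite (Rmult_comm p); right; ring.
  - rewrite sum_list_scal; apply Rmult_le_compat_l.
    + apply Rmult_le_pos; left; [auto|apply exp_pos].
    + apply sum_geometric_wlen; auto; left; apply exp_pos.
Qed.

Lemma translation_inj (g x y : G) : g⁻ ∗ x = g⁻ ∗ y -> x = y.
Proof. apply gmul_inj. Qed.

Lemma translation_inX (g : G) (xi : G -> G -> K) : inX xi -> inX (translation g xi).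
Proof.
  intros [H1 H2]; split; [intros x; apply H1|].
  exact (mfinite_comp Psi (fun x => gauge Phi (xi x)) _ (translation_inj g) H2).
Qed.

Lemma translation_isometric (g : G) (xi : G -> G -> K) :
  inX xi -> gaugePsiPhi Psi Phi (translation g xi) = gaugePsiPhi Psi Phi xi.
Proof.
  intros [H1 H2].
  apply (mgauge_comp Psi HPsi (fun x => gauge Phi (xi x)) (gmul G g⁻) (gmul G g)); auto.
  - apply gmul_Kl.
  - apply gmul_Kr.
  - intros x; apply in_lPhi_gauge_nonneg; auto.
Qed.

Lemma vadd_inX (xi eta : G -> G -> K) : inX xi -> inX eta -> inX (vadd xi eta).
Proof.
  intros [H1 H2] [H1' H2'].
  assert (Hpos : forall (v : G -> K) y, 0 <= sabs K (v y))
    by (intros; apply (sabs_nonneg K inj HK)).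
  assert (Hadd : forall x y, 0 <= sabs K (vadd xi eta x y) <= sabs K (xi x y) + sabs K (eta x y))
    by (intros x y; split; [apply (Hpos (vadd xi eta x))|apply (sabs_add K inj HK)]).
  assert (Hin : forall x, in_lPhi Phi (vadd xi eta x)).
  { intros x; exact (mfinite_add Phi HPhi _ _ _ (Hpos (xi x)) (Hpos (eta x)) (Hadd x)
                       (H1 x) (H1' x)). }
  split; auto.
  apply (mfinite_add Psi HPsi (fun x => gauge Phi (xi x)) (fun x => gauge Phi (eta x))
           (fun x => gauge Phi (vadd xi eta x))); auto using in_lPhi_gauge_nonneg.
  intros x; split; [auto using in_lPhi_gauge_nonneg|].
  exact (mgauge_triangle Phi HPhi _ _ _ (Hpos (xi x)) (Hpos (eta x)) (Hadd x) (H1 x) (H1' x)).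
Qed.

(** Take one geodesic point at each length from [m] to [m + n - 1]; distinct lengths make them
    distinct. *)
Lemma geodesic_list (g : G) (n : nat) :
  (2 * m + n <= len g)%nat ->
  exists l, NoDup l /\ length l = n /\ forall x, In x l ->
    (m <= len x)%nat /\ (m <= len (x⁻ ∗ g))%nat /\ (len x + len (x⁻ ∗ g) = len g)%nat.
Proof.
  intros Hn.
  set (pt := fun i => epsilon (inhabits (gone G))
                        (fun x => len x = i /\ (len (x⁻ ∗ g) = len g - i)%nat)).
  assert (Hpt : forall i, (i <= len g)%nat ->
            len (pt i) = i /\ (len ((pt i)⁻ ∗ g) = len g - i)%nat).
  { intros i Hi; unfold pt; apply epsilon_spec, geodesic_point; auto. }
  exists (map pt (seq m n)); split; [|split].
  - apply NoDup_map_NoDup_ForallPairs; [|apply seq_NoDup].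
    intros i j Hi Hj Heq; apply in_seq in Hi, Hj.
    destruct (Hpt i) as [<- _]; [lia|]; destruct (Hpt j) as [<- _]; [lia|].
    rewrite Heq; auto.
  - rewrite length_map, length_seq; auto.
  - intros x Hx; apply in_map_iff in Hx; destruct Hx as (i & <- & Hi); apply in_seq in Hi.
    destruct (Hpt i); lia.
Qed.

(* At each point of the geodesic the cocycle has a coordinate of size at least [c], so either
   [xi] or its image has one of size at least [c / 2]; the modulars of both are bounded. *)
Lemma action_proper (xi : G -> G -> K) : inX xi -> forall M : R, exists L : list G,
  forall g, ~ In g L -> M < gaugePsiPhi Psi Phi (vadd (translation g xi) (cocycle g)).
Proof.
  intros Hxi M.
  destruct (N_large Phi HPhi) as (T & HT & HPT).
  pose proof Hxi as [Hxi1 (a & Ha & Q & HQ)].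
  pose proof (Rle_abs M); pose proof (Rabs_pos M).
  (* By [mgauge_ge], a row with an entry of size at least [c / 2] has gauge at least [k]. [M1] lies
     strictly above the supposed norm bound, hence is a unit scale. *)
  set (M1 := Rabs M + 1); set (k := c / 2 / T).
  assert (Hk : 0 < k) by (unfold k; repeat apply Rdiv_lt_0_compat; lra).
  assert (HM1 : 0 < M1) by (unfold M1; lra).
  (* The least contribution of one geodesic point to the two modulars, whose sum is at most [1 + Q];
     [n] is then chosen with [n * th > 1 + Q]. *)
  set (th := Rmin (Psi (k / M1)) (Psi (a * k))).
  assert (Hth : 0 < th).
  { apply Rmin_pos; apply (N_pos Psi HPsi); [apply Rdiv_lt_0_compat|nra]; auto. }
  destruct (INR_unbounded ((1 + Q) / th)) as [n Hn].
  exists (ball G S (2 * m + n)); intros g Hg; apply Rnot_le_lt; intros Hle.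
  set (eta := vadd (translation g xi) (cocycle g)) in *.
  assert (Heta : inX eta)
    by (apply vadd_inX; [apply translation_inX; auto|apply cocycle_inX]).
  destruct Heta as [Heta1 Heta2].
  destruct (unit_scale_gt_mgauge Psi HPsi (fun x => gauge Phi (eta x)) M1) as [_ HM].
  { intros x; apply in_lPhi_gauge_nonneg; auto. }
  { exact Heta2. }
  { unfold M1; change (gaugePsiPhi Psi Phi eta < Rabs M + 1); lra. }
  destruct (geodesic_list g n) as (l & Hnd & Hlen & Hl).
  { destruct (Nat.le_gt_cases (2 * m + n) (len g)) as [Hlg|Hlg]; auto.
    exfalso; apply Hg, in_ball; auto; lia. }
  specialize (HM l Hnd).
  pose proof (sum_le_comp (fun x => Psi (a * gauge Phi (xi x))) Q (gmul G g⁻)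
                (translation_inj g) HQ l Hnd) as HQl.
  simpl in HQl.
  assert (Hsum : INR n * th <= 1 + Q).
  { eapply Rle_trans; [|apply Rplus_le_compat; [exact HM|exact HQl]].
    rewrite <- sum_list_add, <- Hlen, <- sum_list_const.
    apply sum_list_le; intros x Hx.
    destruct (Hl x Hx) as (Hx1 & Hx2 & Hx3).
    destruct (HF_separated g x Hx1 Hx2 Hx3) as [y Hy].
    pose proof (sabs_inj_le K inj HK (xi (g⁻ ∗ x) y) (F (x⁻ ∗ g) y - F x⁻ y)) as Htri.
    change (sadd K _ _) with (eta x y) in Htri.
    assert (Hge : forall (v : G -> K) z, in_lPhi Phi v -> c / 2 <= sabs K (v z) ->
              k <= gauge Phi v).
    { intros v z Hv Hz; eapply Rle_trans.
      - apply Rmult_le_compat_r with (r := / T) in Hz;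
          [exact Hz|left; apply Rinv_0_lt_compat; auto].
      - apply (mgauge_ge Phi HPhi T (fun z => sabs K (v z))); auto.
        intros; apply (sabs_nonneg K inj HK). }
    pose proof (in_lPhi_gauge_nonneg _ (Heta1 x)) as Hg1.
    pose proof (in_lPhi_gauge_nonneg _ (Hxi1 (g⁻ ∗ x))) as Hg2.
    assert (HiM : 0 < / M1) by (apply Rinv_0_lt_compat; auto).
    assert (Hp1 : 0 <= Psi (gauge Phi (eta x) / M1))
      by (apply (N_nonneg Psi HPsi), Rle_mult_inv_pos; auto).
    assert (Hp2 : 0 <= Psi (a * gauge Phi (xi (g⁻ ∗ x))))
      by (apply (N_nonneg Psi HPsi); nra).
    destruct (Rle_lt_dec (c / 2) (sabs K (eta x y))) as [H1|H1].
    - apply Hge in H1; auto.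
      assert (Psi (k / M1) <= Psi (gauge Phi (eta x) / M1)).
      { apply (N_mono Psi HPsi); split; [apply Rle_mult_inv_pos; lra|].
        apply Rmult_le_compat_r; lra. }
      pose proof (Rmin_l (Psi (k / M1)) (Psi (a * k))); unfold th; lra.
    - assert (H2 : c / 2 <= sabs K (xi (g⁻ ∗ x) y)) by lra.
      apply Hge in H2; auto.
      assert (Psi (a * k) <= Psi (a * gauge Phi (xi (g⁻ ∗ x)))).
      { apply (N_mono Psi HPsi); split; nra. }
      pose proof (Rmin_r (Psi (k / M1)) (Psi (a * k))); unfold th; lra. }
  apply Rmult_lt_compat_r with (r := th) in Hn; auto.
  replace ((1 + Q) / th * th) with (1 + Q) in Hn by (field; lra); lra.
Qed.

Lemma proper_action : proper_affine_isometric_action G K Psi Phi.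
Proof.
  exists translation, cocycle; cbv zeta.
  split; [exact cocycle_inX|].
  split; [exact translation_inX|].
  split; [reflexivity|].
  split; [exact translation_isometric|].
  split; [|split].
  - intros xi _; extensionality x; extensionality y; unfold vadd, translation, cocycle.
    rewrite ginv_1, gmul_1l, gmul_1r, Rminus_diag; apply (sadd_inj_0 K inj HK).
  - intros g g' xi _; extensionality x; extensionality y; unfold vadd, translation, cocycle.
    (* Since the inverse of [g⁻ ∗ x] is [x⁻ ∗ g], the terms [F (x⁻ ∗ g) y] cancel: the cocycle
       identity telescopes. *)
    rewrite (sadd_inj_add K inj HK), !ginv_mul, ginv_inv, !gmul_assoc.
    f_equal; f_equal; ring.
  - exact action_proper.
Qed.

End Action.

(** * Choice of constants and assembly *)

Lemma hyperbolic_nat (G : Group) (S : list G) :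
  hyperbolic_wrt S -> exists h : nat, forall x y z w : G,
    let d x y := wlen S (gmul G (ginv G x) y) in
    (d x y + d z w <= Nat.max (d x z + d y w) (d x w + d y z) + h)%nat.
Proof.
  (* Distances are integers, so [2 * delta] may be rounded up to a natural number. *)
  intros (delta & _ & H); destruct (INR_unbounded (2 * delta)) as [h Hh].
  exists h; intros x y z w d; specialize (H x y z w); unfold wdist in H.
  fold (d x y) (d z w) (d x z) (d y w) (d x w) (d y z) in H.
  apply INR_le; rewrite !plus_INR.
  eapply Rle_trans; [apply H|]; apply Rplus_le_compat; [|lra].
  apply Rmax_lub; rewrite <- plus_INR; apply le_INR; lia.
Qed.

(** As [ln rho < 0], every exponent above [ln (2 * V) / - ln rho] beats the growth rate [V]; the
    maximum with 2 secures [2 <= p]. *)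
Lemma exponent_exists (V : nat) (rho : R) :
  (0 < V)%nat -> 0 < rho < 1 -> exists p, 2 <= p /\ INR V * Rpower rho p <= / 2.
Proof.
  intros HV Hrho; apply lt_0_INR in HV.
  assert (Hln : 0 < - ln rho) by (pose proof (ln_increasing rho 1); rewrite ln_1 in *; lra).
  set (q := ln (2 * INR V) / - ln rho).
  exists (Rmax 2 q); split; [apply Rmax_l|].
  assert (Hle : Rpower rho (Rmax 2 q) <= / (2 * INR V)).
  { rewrite <- (exp_ln (/ (2 * INR V))) by (apply Rinv_0_lt_compat; lra).
    rewrite ln_Rinv by lra; unfold Rpower.
    pose proof (Rmax_r 2 q) as Hq.
    apply Rmult_le_compat_r with (r := - ln rho) in Hq; [|lra].
    unfold q at 1 in Hq.
    replace (ln (2 * INR V) / - ln rho * - ln rho) with (ln (2 * INR V)) in Hq by (field; lra).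
    assert (Hx : Rmax 2 q * ln rho <= - ln (2 * INR V)) by lra.
    destruct Hx as [Hx| ->]; [left; apply exp_increasing; auto|lra]. }
  apply Rmult_le_compat_l with (r := INR V) in Hle; [|lra].
  replace (INR V * / (2 * INR V)) with (/ 2) in Hle by (field; lra); auto.
Qed.

Theorem mainTheorem6 :
  forall (G : Group), hyperbolic_group G ->
  exists p : R, 2 <= p /\
    forall (complex : bool) (Phi Psi : R -> R),
      N_function Phi -> N_function Psi -> Delta2_N Phi ->
      (exists D t0, 0 < D /\ 0 < t0 /\ forall t, 0 < t <= t0 -> Psi t <= D * Rpower t p) ->
      proper_affine_isometric_action G (Kof complex) Psi Phi.
Proof.
  intros G (S & Hgen & Hhyp).
  destruct (hyperbolic_nat G S Hhyp) as [h Hh]; cbv zeta in Hh.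
  pose proof (decay_bounds G S h) as Hdecay.
  (* The exponent depends on the generating set and on [h] alone, so it is fixed before the
     N-functions. *)
  destruct (exponent_exists (degree G S) (decay G S h)) as (p & Hp2 & Hp); auto.
  { unfold degree, letters; simpl; lia. }
  exists p; split; auto.
  intros complex Phi Psi HPhi HPsi _ HPsi_p.
  destruct (exists_list_bounded G S Hgen
              (fun x => (wlen S x <= 2 * step h)%nat) (2 * step h)) as (B & HBnd & HB); auto.
  assert (HBpos : 0 < INR (length B)).
  { apply lt_0_INR; destruct B; [|simpl; lia].
    exfalso; apply (HB (gone G)); rewrite wlen_1; auto; lia. }
  assert (HK : exists inj, real_embedding (Kof complex) inj).
  { destruct complex; eexists; [apply real_embedding_C|apply real_embedding_R]. }
  destruct HK as [inj HK].
  (* The kernel is [hit], supported in the ball [B] of radius [2 * step h], with separation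
     [/ INR (length B)] at distance at least [step h] from both ends. *)
  apply (proper_action G S Hgen (Kof complex) inj HK Phi Psi HPhi HPsi (hit G S h) B
           (decay G S h) (/ INR (length B)) p (step h)); auto.
  - intros b y Hy; apply hit_support; auto.
    rewrite HB in Hy; lia.
  - intros g; apply hit_decay; auto.
  - apply Rinv_0_lt_compat; auto.
  - intros g x Hx Hxg Hlen; apply hit_separated; auto.
    + rewrite wlen_inv; auto.
    + rewrite ginv_mul, ginv_inv, <- gmul_assoc, gmul_Vr, gmul_1r, !wlen_inv; auto; lia.
Qed.
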